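(* For each $k \in \{6, 7, 8, 9\}$, the hypersurface arrangement $\mathcal{H}_k \subset \mathbb{P}^{14}_{\mathbb{C}}$ defined by $Q_k = f_1 f_2 f_3 f_4 f_5 f_k = 0$ is free with exponents $(\underbrace{1, \ldots, 1}_{13 \text{ times}}, 4)$.
   Context: Let $S = \mathbb{C}[x_1,\ldots,x_5,y_1,\ldots,y_5,z_1,\ldots,z_5]$ be the polynomial ring in 15 variables with its standard grading, the homogeneous coordinate ring of $\mathbb{P}^{14}_{\mathbb{C}}$. Consider the generic matrix $$M = \begin{pmatrix} x_1 & x_2 & x_3 & x_4 & x_5 \\ y_1 & y_2 & y_3 & y_4 & y_5 \\ z_1 & z_2 & z_3 & z_4 & z_5 \end{pmatrix}.$$ For $1 \leq a < b < c \leq 5$ let $\Delta_{abc} \in S$ denote the determinant of the $3\times 3$ submatrix of $M$ formed by columns $a,b,c$ (in this order). Set $f_1 = \Delta_{123}$, $f_2 = \Delta_{124}$, $f_3 = \Delta_{134}$, $f_4 = \Delta_{234}$, $f_5 = \Delta_{125}$, $f_6 = \Delta_{135}$, $f_7 = \Delta_{235}$, $f_8 = \Delta_{145}$, $f_9 = \Delta_{245}$, $f_{10} = \Delta_{345}$. Freeness and exponents: for a reduced homogeneous polynomial $F \in S$ let $\mathrm{AR}(F)$ be the graded $S$-module of Jacobian syzygies, i.e. of all tuples $(a_v)_v \in S^{15}$, indexed by the 15 variables $v$, such that $\sum_v a_v\, \partial F/\partial v = 0$ (a tuple whose entries are homogeneous of degree $e$ has degree $e$). Equivalently, $\mathrm{AR}(F)$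 is the module $D_0$ of polynomial derivations killing $F$. The hypersurface $F = 0$ is called free if $\mathrm{AR}(F)$ is a free $S$-module; its rank is then 14, and its exponents are the multiset $(d_1 \leq \cdots \leq d_{14})$ of degrees of a homogeneous basis, so that $\mathrm{AR}(F) \cong \bigoplus_{i=1}^{14} S(-d_i)$. *)

(* Defs.v *)
From HB Require Import structures.
From mathcomp Require Import all_boot all_order all_algebra.
From mathcomp Require Import mpoly.

Set Implicit Arguments.
Unset Strict Implicit.
Unset Printing Implicit Defensive.

Import GRing.Theory.
Local Open Scope ring_scope.

Section Freeness.
Variables (K : fieldType) (n : nat).
Local Notation S := {mpoly K[n]}.
Implicit Types (F : S) (ds : seq nat).

(* No square of a non-unit divides F; in particular F != 0. *)
Definition reduced F : Prop :=
  forall p q : S, F = p ^+ 2 * q -> p \is a GRing.unit.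

Definition AR F : {pred 'rV[S]_n} :=
  [pred a : 'rV[S]_n | \sum_(v < n) a 0 v * F^`M(v) == 0].

(* All entries are homogeneous of the same degree e; zero entries are allowed,
   as 0 is e.-homog for every e. *)
Definition tuple_homog (e : nat) (a : 'rV[S]_n) : Prop :=
  forall v, a 0 v \is e.-homog.

Definition AR_basis F (r : nat) (b : 'I_r -> 'rV[S]_n) : Prop :=
  (forall i, b i \in AR F) /\
  (forall a, a \in AR F -> exists! c : 'rV[S]_r, a = \sum_(i < r) c 0 i *: b i).

Definition free_hypersurface F : Prop :=
  [/\ F \is homog mdeg, reduced F &
      exists (r : nat) (b : 'I_r -> 'rV[S]_n), AR_basis F b].

(* The exponents form a multiset: the order of ds is immaterial, since a basis
   may be reindexed. *)
Definition has_exponents F ds : Prop :=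
  exists2 b : 'I_(size ds) -> 'rV[S]_n,
    AR_basis F b & forall i : 'I_(size ds), tuple_homog (nth 0%N ds i) (b i).

End Freeness.

Section Arrangement.
Variable K : fieldType.
Local Notation S := {mpoly K[15]}.

(* Row i of the matrix (i = 0, 1, 2 for x, y, z) consists of the variables
   with indices 5i, ..., 5i + 4. *)
Definition genericM : 'M[S]_(3, 5) :=
  \matrix_(i < 3, j < 5) 'X_(inord (5 * i + j)%N : 'I_15).

(* Column labels a, b, c are 1-based, hence the predecessor. *)
Definition Delta (a b c : nat) : S :=
  \det (colsub (fun j : 'I_3 => inord (nth 0%N [:: a; b; c] j).-1 : 'I_5)
               genericM).

Definition f (k : nat) : S :=
  nth 0 [:: Delta 1 2 3; Delta 1 2 4; Delta 1 3 4; Delta 2 3 4; Delta 1 2 5;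
            Delta 1 3 5; Delta 2 3 5; Delta 1 4 5; Delta 2 4 5; Delta 3 4 5]
      k.-1.

Definition Q (k : nat) : S := f 1 * f 2 * f 3 * f 4 * f 5 * f k.

End Arrangement.

(* Main.v *)
(* By Saito's criterion it is enough to find 15 derivations preserving the ideals
   of all six minors whose matrix of coefficients has determinant a nonzero
   constant times Q_k; since each minor is prime, the product of the minors
   divides that determinant, so that only its degree (18) and its value at one
   point matter. Up to sign and a permutation of the first four columns
   a, b, c, d, the minors are abc, abd, acd, bcd, abw and acw, where w is the
   fifth column. The linear derivations come from row operations (9), column
   scalings (4 more) and w += a; the last one is w += abw * c, of degree 4: it
   kills acw and multiplies abw by abc. One column scaling is used to correct the
   other 14 derivations so that they kill Q_k. *)
From HB Require Import structures.
Require Import Defs.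
From mathcomp Require Import all_boot all_order all_algebra.
From mathcomp Require Import reals.
From mathcomp Require Import complex.
From mathcomp Require Import fraction perm mpoly ring zify.

Set Implicit Arguments.
Unset Strict Implicit.
Unset Printing Implicit Defensive.

Import GRing.Theory.
Local Open Scope ring_scope.

(** * Products of pairwise non-associate primes *)

Section Divisibility.
Variable R : idomainType.
Implicit Types p q r : R.

Definition divides p q := exists r, q = r * p.

Definition prime_elt p :=
  [/\ p != 0, ~ divides p 1 &
      forall q r, divides p (q * r) -> divides p q \/ divides p r].

Lemma dividesD p q r : divides p q -> divides p r -> divides p (q + r).
Proof. by case=> a -> [b ->]; exists (a + b); rewrite mulrDl. Qed.

Lemma divides_mull p q r : divides p r -> divides p (q * r).
Proof. by case=> a ->; exists (q * a); rewrite mulrA. Qed.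

Lemma divides_mulr p q r : divides p q -> divides p (q * r).
Proof. by move=> pq; rewrite mulrC; apply: divides_mull. Qed.

Lemma divides_sum (I : Type) (s : seq I) p (F : I -> R) :
  (forall i, divides p (F i)) -> divides p (\sum_(i <- s) F i).
Proof.
move=> pF; elim: s => [|i s IHs]; first by exists 0; rewrite big_nil mul0r.
by rewrite big_cons; apply: dividesD.
Qed.

Section PairwiseNonAssociate.
Variables (I : eqType) (P : I -> R).
Hypothesis primeP : forall i, prime_elt (P i).
Hypothesis ndvdP : forall i j, i != j -> ~ divides (P i) (P j).

Lemma prime_ndvd_prod i (s : seq I) :
  i \notin s -> ~ divides (P i) (\prod_(j <- s) P j).
Proof.
have [_ P1 PM] := primeP i.
elim: s => [|j s IHs]; first by rewrite big_nil.
rewrite inE negb_or big_cons => /andP[ij /IHs nis] /PM[|//].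
exact: ndvdP.
Qed.

Lemma prod_primes_dvd (s : seq I) d :
  uniq s -> (forall i, divides (P i) d) -> divides (\prod_(i <- s) P i) d.
Proof.
move=> us Pd; elim: s us => [|i s IHs]; first by exists d; rewrite big_nil mulr1.
move=> /= /andP[nis /IHs[r dE]]; have [_ _ PM] := primeP i.
have := Pd i; rewrite dE => /PM[[t ->]|/(prime_ndvd_prod nis)//].
by exists t; rewrite big_cons mulrA.
Qed.

(** If [P i] divided [p], it would divide the product of the other primes; so it divides [q], and
    cancels. *)
Lemma prod_primes_squarefree (s : seq I) p q :
  uniq s -> \prod_(i <- s) P i = p ^+ 2 * q -> p \is a GRing.unit.
Proof.
elim: s q => [|i s IHs] q /=.
  rewrite big_nil expr2 -mulrA => _ pq1.
  by apply/unitrP; exists (p * q); rewrite [_ * q * p]mulrC -pq1.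
move=> /andP[nis us]; rewrite big_cons; have [P0 _ PM] := primeP i.
move=> E; suff [q' qE] : divides (P i) q.
  by apply: (IHs q') => //; apply: (mulfI P0); rewrite E qE; ring.
have npp : ~ divides (P i) p.
  case=> r pE; apply: (prime_ndvd_prod nis); exists (r ^+ 2 * q).
  by apply: (mulfI P0); rewrite E pE; ring.
have : divides (P i) (p * (p * q)).
  by exists (\prod_(j <- s) P j); rewrite [RHS]mulrC E; ring.
by case/PM => // /PM[].
Qed.

End PairwiseNonAssociate.
End Divisibility.

(** * Primality of polynomials linear in one variable *)

Section LinearPrime.
Variables (K : fieldType) (n : nat).
Local Notation S := {mpoly K[n]}.

(** Values in the fraction field allow a quotient to replace the variable. *)
Definition subst_var (v : 'I_n) (x : {fraction S}) : S -> {fraction S} :=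
  mmap (@FracField.tofrac S \o @mpolyC n K)
    (fun w => if w == v then x else FracField.tofrac 'X_w).

HB.instance Definition _ v x := GRing.RMorphism.copy (subst_var v x)
  (mmap (@FracField.tofrac S \o @mpolyC n K) _).

Lemma subst_varX v x w :
  subst_var v x 'X_w = if w == v then x else FracField.tofrac 'X_w.
Proof. by rewrite /subst_var mmapX mmap1U. Qed.

Definition free_of_var v (p : S) :=
  forall x, subst_var v x p = FracField.tofrac p.

Lemma free_of_var1 v : free_of_var v 1.
Proof. by move=> x; rewrite !rmorph1. Qed.

Lemma free_of_var0 v : free_of_var v 0.
Proof. by move=> x; rewrite !rmorph0. Qed.

Lemma free_of_varX v w : w != v -> free_of_var v 'X_w.
Proof. by move=> wv x; rewrite subst_varX (negbTE wv). Qed.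

Lemma free_of_varB v p q :
  free_of_var v p -> free_of_var v q -> free_of_var v (p - q).
Proof. by move=> pv qv x; rewrite !rmorphB /= pv qv. Qed.

Lemma free_of_varM v p q :
  free_of_var v p -> free_of_var v q -> free_of_var v (p * q).
Proof. by move=> pv qv x; rewrite !rmorphM /= pv qv. Qed.

(* The kernel of the substitution of [- B / A] for ['X_v] is the saturation of
   the ideal generated by [A * 'X_v + B] with respect to [A]; the last
   hypothesis says that saturating changes nothing. *)
Lemma prime_linear v (A B : S) :
    A != 0 -> free_of_var v A -> free_of_var v B ->
    (forall h, divides A ((A * 'X_v + B) * h) -> divides A h) ->
  prime_elt (A * 'X_v + B).
Proof.
move=> A0 vA vB satA; set P := A * 'X_v + B.
have phiP x : subst_var v x P = FracField.tofrac A * x + FracField.tofrac B.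
  by rewrite rmorphD rmorphM /= subst_varX eqxx vA vB.
have P0 : P != 0.
  (* The values at 0 and 1 differ by [A], so they cannot both vanish. *)
  apply: contraNneq A0 => P0; have := phiP 0; have := phiP 1.
  rewrite P0 !rmorph0 mulr0 add0r mulr1 => AB0 B0.
  by rewrite -tofrac_eq0; move: AB0; rewrite -B0 addr0 => <-.
pose x := - FracField.tofrac B / FracField.tofrac A.
have xP : subst_var v x P = 0.
  by rewrite phiP mulrC divfK ?tofrac_eq0 // addNr.
(* Pseudo-division: modulo [P], [A * 'X_v] is [- B], so multiplying [p] by a power of [A] eliminates
   ['X_v]. *)
have clear_denoms p : exists N, exists g : S,
    FracField.tofrac A ^+ N * subst_var v x p = FracField.tofrac g /\
    divides P (A ^+ N * p - g).
  have mulstep q1 q2 :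
      (exists N, exists g : S,
         FracField.tofrac A ^+ N * subst_var v x q1 = FracField.tofrac g /\
         divides P (A ^+ N * q1 - g)) ->
      (exists N, exists g : S,
         FracField.tofrac A ^+ N * subst_var v x q2 = FracField.tofrac g /\
         divides P (A ^+ N * q2 - g)) ->
      exists N, exists g : S,
         FracField.tofrac A ^+ N * subst_var v x (q1 * q2) = FracField.tofrac g /\
         divides P (A ^+ N * (q1 * q2) - g).
    move=> [N1 [g1 [E1 D1]]] [N2 [g2 [E2 D2]]].
    exists (N1 + N2)%N; exists (g1 * g2); split.
      by rewrite !rmorphM /= -E1 -E2 exprD; ring.
    have -> : A ^+ (N1 + N2) * (q1 * q2) - g1 * g2
            = (A ^+ N1 * q1 - g1) * (A ^+ N2 * q2) + g1 * (A ^+ N2 * q2 - g2).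
      by rewrite exprD; ring.
    by apply: dividesD; [apply: divides_mulr | apply: divides_mull].
  have unitstep (c : K) : exists N, exists g : S,
      FracField.tofrac A ^+ N * subst_var v x c%:MP = FracField.tofrac g /\
      divides P (A ^+ N * c%:MP - g).
    exists 0; exists c%:MP; split; last by exists 0; rewrite expr0; ring.
    by rewrite expr0 mul1r /subst_var mmapC.
  elim/mpolyind: p => [|c m p _ _ [N1 [g1 [E1 D1]]]].
    by rewrite -mpolyC0; apply: (unitstep).
  have [N2 [g2 [E2 D2]]] : exists N, exists g : S,
      FracField.tofrac A ^+ N * subst_var v x (c *: 'X_[m]) = FracField.tofrac g
      /\ divides P (A ^+ N * (c *: 'X_[m]) - g).
    rewrite -mul_mpolyC; apply: (mulstep); first exact: unitstep.
    rewrite mpolyXE_id; elim/big_rec: _ => [|i q _ IHq].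
      by rewrite -mpolyC1; apply: (unitstep).
    apply: (mulstep) => //; elim: (m i) => [|k IHk].
      by rewrite expr0 -mpolyC1; apply: (unitstep).
    rewrite exprS; apply: (mulstep) => //.
    have [->|iv] := eqVneq i v; last first.
      exists 0; exists 'X_i; split; last by exists 0; rewrite expr0; ring.
      by rewrite expr0 mul1r subst_varX (negbTE iv).
    exists 1; exists (- B); rewrite !expr1; split.
      by rewrite subst_varX eqxx mulrC divfK ?tofrac_eq0 // rmorphN.
    by exists 1; rewrite mul1r opprK.
  exists (N1 + N2)%N; exists (A ^+ N1 * g2 + A ^+ N2 * g1); split.
    by rewrite !rmorphD !rmorphM !rmorphXn /= -E1 -E2 exprD; ring.
  have -> : A ^+ (N1 + N2) * (c *: 'X_[m] + p) - (A ^+ N1 * g2 + A ^+ N2 * g1)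
    = A ^+ N1 * (A ^+ N2 * (c *: 'X_[m]) - g2) + A ^+ N2 * (A ^+ N1 * p - g1).
    by rewrite exprD; ring.
  by apply: dividesD; apply: divides_mull.
have kerP p : subst_var v x p = 0 -> divides P p.
  move=> xp; have [N [g []]] := clear_denoms p.
  rewrite xp mulr0 => /esym/eqP; rewrite tofrac_eq0 => /eqP -> {g}.
  (* The factors [A] are removed one at a time: by [satA], [A] divides the cofactor of [P], and
     cancels. *)
  rewrite subr0; elim: N => [|N IHN]; first by rewrite expr0 mul1r.
  case=> h E; apply: IHN.
  have [|r hE] := satA h; first 
    by exists (A ^+ N * p); rewrite [LHS]mulrC -E exprS; ring.
  exists r; apply: (mulfI A0); transitivity (A ^+ N.+1 * p).
    by rewrite exprS mulrA.
  by rewrite E hE; ring.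
(* By [xP] and [kerP], [P] generates the kernel of a morphism to a field. *)
split=> // [[r /(congr1 (subst_var v x))/eqP]|q r [t E]].
  by rewrite rmorphM /= xP mulr0 rmorph1 oner_eq0.
have := congr1 (subst_var v x) E; rewrite !rmorphM /= xP mulr0 => /eqP.
by rewrite mulf_eq0 => /orP[] /eqP /kerP; [left | right].
Qed.

End LinearPrime.

(** * Derivations given by their rows of coefficients *)

Section Derivations.
Variables (K : fieldType) (n : nat).
Local Notation S := {mpoly K[n]}.
Implicit Types (a b : 'rV[S]_n) (p q : S).

Definition der a p : S := \sum_(v < n) a 0 v * p^`M(v).

Lemma der0 a : der a 0 = 0.
Proof. by rewrite /der big1 // => v _; rewrite mderiv0 mulr0. Qed.

Lemma derD a p q : der a (p + q) = der a p + der a q.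
Proof.
by rewrite /der -big_split; apply: eq_bigr => v _; rewrite mderivD mulrDr.
Qed.

Lemma derN a p : der a (- p) = - der a p.
Proof. by apply/eqP; rewrite -addr_eq0 -derD addNr der0. Qed.

Lemma derM a p q : der a (p * q) = der a p * q + p * der a q.
Proof.
rewrite /der mulr_suml mulr_sumr -big_split; apply: eq_bigr => v _ /=.
by rewrite mderivM; ring.
Qed.

Lemma derX a w : der a 'X_w = a 0 w.
Proof.
rewrite /der (bigD1 w) //= mderivX mnm1E eqxx big1 => [|v vw].
  rewrite addr0 (_ : (U_(w) - U_(w))%MM = 0%MM) ?mpolyX0 ?scale1r ?mulr1 //.
  by apply/mnmP => i; rewrite mnmBE subnn mnm0E.
by rewrite mderivX mnm1E eq_sym (negbTE vw) scale0r mulr0.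
Qed.

Lemma der_mulmx m (c : 'rV[S]_m) (A : 'M[S]_(m, n)) p :
  der (c *m A) p = \sum_i c 0 i * der (row i A) p.
Proof.
rewrite /der; under eq_bigr do rewrite mxE mulr_suml.
rewrite exchange_big; apply: eq_bigr => i _ /=.
by rewrite mulr_sumr; apply: eq_bigr => v _; rewrite mxE mulrA.
Qed.

End Derivations.

(** * Degrees of divisors and determinants *)

Section HomogeneousMPoly.
Variables (K : fieldType) (n : nat).
Local Notation S := {mpoly K[n]}.

Lemma dhomog_msizeE d (p : S) : p != 0 -> p \is d.-homog -> msize p = d.+1.
Proof.
move=> p0 pd; rewrite -(dhomog_uniq p0 (dhomog_msize pd) pd) prednK //.
by rewrite lt0n msize_poly_eq0.
Qed.

(** Degrees add up in a product, so the cofactor has degree 0. *)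
Lemma dhomog_divides d (p q : S) :
    q != 0 -> p \is d.-homog -> q \is d.-homog -> divides p q ->
  exists2 c, c != 0 & q = c%:MP * p.
Proof.
move=> q0 pd qd [r qE]; move: (q0); rewrite qE mulf_eq0 negb_or => /andP[r0 p0].
have := dhomog_msizeE q0 qd; rewrite qE msizeM // (dhomog_msizeE p0 pd).
rewrite addnS /= => /eqP; rewrite -[X in _ == X]add1n eqn_add2r.
by case/msize_poly1P => c c0 ->; exists c.
Qed.

Lemma dhomog_bigprod (I : finType) (d : I -> nat) (F : I -> S) :
  (forall i, F i \is (d i).-homog) -> \prod_i F i \is (\sum_i d i).-homog.
Proof.
move=> Fd; apply: (big_ind2 (fun (p : S) e => p \is e.-homog)) => //.
  exact: dhomog1.
by move=> p e q e'; apply: dhomogM.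
Qed.

Lemma dhomog_det m (d : 'I_m -> nat) (A : 'M[S]_m) :
  (forall i j, A i j \is (d i).-homog) -> \det A \is (\sum_i d i).-homog.
Proof.
move=> Ad; apply: rpred_sum => s _; rewrite rpredMsign.
exact: (dhomog_bigprod (fun i => Ad i (s i))).
Qed.

End HomogeneousMPoly.

(** * Saito's criterion for logarithmic derivations *)

Section Saito.
Variables (K : fieldType) (n : nat).
Local Notation S := {mpoly K[n]}.

(* The gradient of [p] is killed modulo [p] by the matrix [A], hence by its
   determinant, while it does not vanish modulo [p]. *)
Lemma prime_dvd_det_log (p : S) (A : 'M[S]_n) (c : 'rV[S]_n) :
    prime_elt p -> ~ divides p (der c p) ->
    (forall k, divides p (der (row k A) p)) ->
  divides p (\det A).
Proof.
move=> [_ _ pM] ncp Ap.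
suff : divides p (\det A * der c p) by case/pM.
have -> : \det A * der c p = der ((c *m \adj A) *m A) p.
  rewrite -mulmxA mul_adj_mx mul_mx_scalar /der mulr_sumr.
  by apply: eq_bigr => v _; rewrite mxE mulrA.
by rewrite der_mulmx; apply: divides_sum => k; apply: divides_mull.
Qed.

(** Cramer's rule, before dividing by the determinant. *)
Lemma mulmx_adj_det (R : comNzRingType) m (a : 'rV[R]_m) (A : 'M[R]_m) i :
  (a *m \adj A) 0 i = \det (\matrix_k (if k == i then a else row k A)).
Proof.
rewrite (expand_det_row _ i) mxE; apply: eq_bigr => j _; rewrite !mxE eqxx.
congr (_ * (_ * \det _)); apply/matrixP => k l; rewrite !mxE.
by rewrite eq_sym (negbTE (neq_lift _ _)) mxE.
Qed.

Variables (I : finType) (P : I -> S).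
Hypothesis primeP : forall i, prime_elt (P i).
Hypothesis ndvdP : forall i j, i != j -> ~ divides (P i) (P j).
Hypothesis smoothP : forall i, exists c, ~ divides (P i) (der c (P i)).

Let F := \prod_i P i.

Definition logarithmic (a : 'rV[S]_n) :=
  forall i, divides (P i) (der a (P i)).

(** Write [F = P i * g]. By the Leibniz rule [P i] divides [der a (P i) * g], and it does not divide
    [g]. *)
Lemma AR_logarithmic a : a \in AR F -> logarithmic a.
Proof.
move=> /eqP aF i; have [_ _ PM] := primeP i.
have : divides (P i) (der a (P i) * \prod_(j <- rem i (index_enum I)) P j).
  set g := \prod_(j <- _) _.
  have FE : F = P i * g by rewrite /F (big_rem i) ?mem_index_enum.
  exists (- der a g); apply/eqP; rewrite mulNr -addr_eq0 [_ * P i]mulrC.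
  by rewrite -derM -FE; apply/eqP.
case/PM => // /(prime_ndvd_prod primeP ndvdP) []//.
by rewrite mem_rem_uniqF ?index_enum_uniq.
Qed.

Variable t : 'M[S]_n.
Hypothesis log_t : forall k, logarithmic (row k t).

Lemma prod_dvd_det_log (A : 'M[S]_n) :
  (forall k, logarithmic (row k A)) -> divides F (\det A).
Proof.
move=> logA; apply: prod_primes_dvd => // [|i]; first exact: index_enum_uniq.
by have [c nc] := smoothP i; apply: (prime_dvd_det_log _ nc) => // k; apply: logA.
Qed.

Variable d : 'I_n -> nat.
Hypothesis homog_t : forall i j, t i j \is (d i).-homog.
Hypothesis homog_F : F \is (\sum_i d i).-homog.
Hypothesis det_t_neq0 : \det t != 0.

(** In Cramer's rule, replacing a row of [t] by [a] keeps all rows logarithmic, so [F] divides each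
    numerator; the denominator [\det t] is a constant times [F] by degree. *)
Lemma saito_log (a : 'rV[S]_n) : logarithmic a -> exists r, a = r *m t.
Proof.
move=> log_a.
have [c c0 detE] : exists2 c, c != 0 & \det t = c%:MP * F.
  apply: (dhomog_divides det_t_neq0 homog_F); first exact: dhomog_det.
  exact: prod_dvd_det_log.
have /fin_all_exists[r rE] i : exists r, (a *m \adj t) 0 i = r * F.
  rewrite mulmx_adj_det; apply: prod_dvd_det_log => k.
  by rewrite rowK; case: eqP.
exists (c^-1%:MP *: \row_i r i).
have F0 : F != 0 by move: det_t_neq0; rewrite detE mulf_eq0 negb_or => /andP[].
have rF : F *: \row_i r i = a *m \adj t.
  by apply/rowP => i; rewrite !mxE mulrC -rE mxE.
have : F *: a = F *: (c^-1%:MP *: \row_i r i *m t).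
  rewrite -scalemxAl scalerA mulrC -scalerA scalemxAl rF -mulmxA mul_adj_mx.
  rewrite mul_mx_scalar detE scalerA mulrA -mpolyCM mulVf // mpolyC1.
  by rewrite mul1r.
move/rowP => E; apply/rowP => i; apply: (mulfI F0).
by have := E i; rewrite !mxE.
Qed.

End Saito.

(** * From logarithmic derivations to Jacobian syzygies *)

Section SaitoAR.
Variables (K : fieldType) (r : nat).
Local Notation n := r.+1.
Local Notation S := {mpoly K[n]}.
Variables (I : finType) (P : I -> S).
Hypothesis primeP : forall i, prime_elt (P i).
Hypothesis ndvdP : forall i j, i != j -> ~ divides (P i) (P j).
Hypothesis smoothP : forall i, exists c, ~ divides (P i) (der c (P i)).

Let F := \prod_i P i.

Variables (t : 'M[S]_n) (d : 'I_n -> nat).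
Hypothesis log_t : forall k, logarithmic P (row k t).
Hypothesis homog_t : forall i j, t i j \is (d i).-homog.
Hypothesis homog_F : F \is (\sum_i d i).-homog.
Hypothesis det_t_neq0 : \det t != 0.
Hypothesis AR_t : forall j : 'I_r, row (widen_ord (leqnSn r) j) t \in AR F.
Hypothesis max_t : der (row ord_max t) F = F.

Lemma mulmx_row_widen (c : 'rV[S]_n) :
  c *m t = \sum_(j < r) c 0 (widen_ord (leqnSn r) j) *:
             row (widen_ord (leqnSn r) j) t + c 0 ord_max *: row ord_max t.
Proof. by rewrite mulmx_sum_row big_ord_recr. Qed.

(** Applied to [F], a combination of the rows of [t] leaves only its last coefficient times [F]; it
    kills [F] only if that coefficient is 0. Uniqueness comes from [\det t != 0], after padding [c']
    with a last coordinate 0. *)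
Lemma saito_AR_basis :
  AR_basis F (fun j : 'I_r => row (widen_ord (leqnSn r) j) t).
Proof.
split=> // a aF.
have F0 : F != 0 by apply/prodf_neq0 => i _; case: (primeP i).
have [c aE] : exists c, a = c *m t.
  by apply: (saito_log primeP ndvdP smoothP) => //; apply: AR_logarithmic aF.
have cmax : c 0 ord_max = 0.
  move: aF => /eqP; rewrite -/(der _ _) aE der_mulmx big_ord_recr /= big1.
    by rewrite add0r max_t => /eqP; rewrite mulf_eq0 (negbTE F0) orbF => /eqP.
  by move=> j _; rewrite [der _ _](eqP (AR_t j)) mulr0.
exists (\row_j c 0 (widen_ord (leqnSn r) j)); split.
  rewrite aE mulmx_row_widen cmax scale0r addr0.
  by apply: eq_bigr => j _; rewrite mxE.
move=> c' aE'.
pose u := \row_i (if unlift ord_max i is Some j then c' 0 j else 0) : 'rV[S]_n.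
have uw j : u 0 (widen_ord (leqnSn r) j) = c' 0 j.
  rewrite mxE (_ : widen_ord _ j = lift ord_max j) ?liftK //.
  by apply: val_inj; rewrite /= /bump leqNgt ltn_ord.
have umax : u 0 ord_max = 0 by rewrite mxE unlift_none.
have ut : u *m t = a.
  rewrite mulmx_row_widen umax scale0r addr0 aE'.
  by apply: eq_bigr => j _; rewrite uw.
have : (c - u) *m t *m \adj t = 0 by rewrite mulmxBl ut aE subrr mul0mx.
rewrite -mulmxA mul_mx_adj mul_mx_scalar => /rowP E.
apply/rowP => j; rewrite -uw mxE; apply/eqP; rewrite -subr_eq0.
have /eqP := E (widen_ord (leqnSn r) j).
by rewrite !mxE mulf_eq0 (negbTE det_t_neq0).
Qed.

Lemma prod_primes_reduced : reduced F.
Proof.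
move=> p q; apply: (prod_primes_squarefree primeP ndvdP).
exact: index_enum_uniq.
Qed.

End SaitoAR.

(** * Primality and smoothness of the minors *)

Section SixMinors.
Variables (K : fieldType).
Local Notation S := {mpoly K[15]}.

Local Notation r0 := (@Ordinal 3 0 isT).
Local Notation r1 := (@Ordinal 3 1 isT).
Local Notation r2 := (@Ordinal 3 2 isT).
Local Notation c0 := (@Ordinal 5 0 isT).
Local Notation c1 := (@Ordinal 5 1 isT).
Local Notation c2 := (@Ordinal 5 2 isT).
Local Notation c3 := (@Ordinal 5 3 isT).
Local Notation c4 := (@Ordinal 5 4 isT).

(* [e i j] is the index of the variable in row [i] and column [j]; the columns may
   be permuted. *)
Variables (e : 'I_3 -> 'I_5 -> 'I_15) (e' : 'I_15 -> 'I_3 * 'I_5).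
Hypothesis eK : forall i j, e' (e i j) = (i, j).

Let X i j : S := 'X_(e i j).

Definition minor3 i j k : S :=
    X r0 i * (X r1 j * X r2 k - X r2 j * X r1 k)
  - X r1 i * (X r0 j * X r2 k - X r2 j * X r0 k)
  + X r2 i * (X r0 j * X r1 k - X r1 j * X r0 k).

Definition field_row (T : 'I_3 -> 'I_5 -> S) : 'rV[S]_15 :=
  \row_v T (e' v).1 (e' v).2.

Lemma der_field_row T i j : der (field_row T) (X i j) = T i j.
Proof. by rewrite derX mxE eK. Qed.

Definition ev (p : 'I_3 -> 'I_5 -> K) : S -> K :=
  meval (fun v => p (e' v).1 (e' v).2).

HB.instance Definition _ p := GRing.RMorphism.copy (ev p)
  (meval (fun v => p (e' v).1 (e' v).2)).

Lemma evX p i j : ev p (X i j) = p i j.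
Proof. by rewrite /ev mevalXU eK. Qed.

Lemma ev_ndvd pt (p q : S) : ev pt p = 0 -> ev pt q != 0 -> ~ divides p q.
Proof. by move=> p0 q0 [r qE]; rewrite qE rmorphM /= p0 mulr0 eqxx in q0. Qed.

(** For distinct [i], [j], [k], the matrix with the standard basis vectors in these columns and 0
    elsewhere. *)
Definition basis_pt (i j k : 'I_5) (r : 'I_3) (c : 'I_5) : K :=
  ([&& c == i & r == r0] || [&& c == j & r == r1] || [&& c == k & r == r2])%:R.

Lemma e_neq i j i' j' : (i, j) != (i', j') -> e i j != e i' j'.
Proof. by apply: contraNneq => E; rewrite -!eK E. Qed.

Lemma ev0 p : ev p 0 = 0. Proof. exact: rmorph0. Qed.
Lemma ev1 p : ev p 1 = 1. Proof. exact: rmorph1. Qed.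
Lemma evN p q : ev p (- q) = - ev p q. Proof. exact: rmorphN. Qed.
Lemma evD p q r : ev p (q + r) = ev p q + ev p r. Proof. exact: rmorphD. Qed.
Lemma evM p q r : ev p (q * r) = ev p q * ev p r. Proof. exact: rmorphM. Qed.

Lemma evMn p q n : ev p (q *+ n) = ev p q *+ n. Proof. exact: rmorphMn. Qed.

Let evE := (ev0, ev1, evD, evN, evMn, evM, evX).

Section DistinctColumns.
Variables i j k : 'I_5.
Hypotheses (ij : i != j) (ik : i != k) (jk : j != k).
Let ji : j != i. Proof. by rewrite eq_sym. Qed.
Let ki : k != i. Proof. by rewrite eq_sym. Qed.
Let kj : k != j. Proof. by rewrite eq_sym. Qed.
Let neqs := (negbTE ij, negbTE ik, negbTE jk, negbTE ji, negbTE ki, negbTE kj,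
  eqxx).

Lemma prime_var r : prime_elt (X r i).
Proof.
rewrite -[X r i]mul1r -[1 * _]addr0; apply: prime_linear.
- exact: oner_neq0.
- exact: free_of_var1.
- exact: free_of_var0.
by move=> h _; exists h; rewrite mulr1.
Qed.

(** A minor is linear in its last entry, with the next smaller minor as coefficient. That
    coefficient is prime and does not divide the minor, whence the saturation hypothesis of
    [prime_linear]. *)
Lemma prime_minor2 : prime_elt (X r0 i * X r1 j - X r1 i * X r0 j).
Proof.
have [X0 _ XM] := prime_var r0; apply: prime_linear => //.
- by apply: free_of_varX; apply: e_neq; rewrite xpair_eqE.
- rewrite -sub0r; apply: free_of_varB; first exact: free_of_var0.
  by apply: free_of_varM; apply: free_of_varX; apply: e_neq;
     rewrite xpair_eqE ?neqs ?andbF.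
move=> h /XM[|//].
suff /[apply] : ~ divides (X r0 i) (X r0 i * X r1 j - X r1 i * X r0 j) by [].
apply: (@ev_ndvd (basis_pt j i k)); rewrite !evE /basis_pt !neqs //=.
by rewrite mul0r sub0r mul1r oppr_eq0 oner_neq0.
Qed.

Lemma prime_minor3 : prime_elt (minor3 i j k).
Proof.
set A := X r0 i * X r1 j - X r1 i * X r0 j.
set B := X r0 j * (X r2 i * X r1 k) - X r0 k * (X r2 i * X r1 j)
       - (X r0 i * (X r2 j * X r1 k) - X r1 i * (X r2 j * X r0 k)).
have -> : minor3 i j k = A * X r2 k + B by rewrite /A /B /minor3; ring.
have [A0 _ AM] := prime_minor2; apply: prime_linear => //.
- by do ?[apply: free_of_varB | apply: free_of_varM | apply: free_of_varX;
     apply: e_neq; rewrite xpair_eqE ?neqs ?andbF].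
- by do ?[apply: free_of_varB | apply: free_of_varM | apply: free_of_varX;
     apply: e_neq; rewrite xpair_eqE ?neqs ?andbF].
move=> h /AM[|//]; suff /[apply] : ~ divides A (A * X r2 k + B) by [].
(* With [j] and [k] exchanged, [A] vanishes and the 3 by 3 minor is -1. *)
apply: (@ev_ndvd (basis_pt i k j)); rewrite !evE /basis_pt !neqs /=.
  by ring.
by rewrite [X in X != 0](_ : _ = -1) ?oppr_eq0 ?oner_neq0 //; ring.
Qed.

Lemma minor3_smooth : exists c, ~ divides (minor3 i j k) (der c (minor3 i j k)).
Proof.
(* The partial derivative in [X r2 k] is the top minor of columns [i] and [j]. It is 1 at the point
   below, where column [k] is 0. *)
exists (field_row (fun r c => ((c == k) && (r == r2))%:R)).
rewrite /minor3 !(derD, derN, derM) !der_field_row !neqs /=.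
apply: (@ev_ndvd
  (fun r c => ((c == i) && (r == r0) || (c == j) && (r == r1))%:R)).
  by rewrite !evE !neqs /=; ring.
rewrite !evE !neqs /=.
by rewrite [X in X != 0](_ : _ = 1) ?oner_neq0 //; ring.
Qed.

End DistinctColumns.

Lemma homog_var r c : X r c \is 1.-homog.
Proof. by rewrite dhomogX /= mdeg1. Qed.

Lemma homog_minor3 i j k : minor3 i j k \is 3.-homog.
Proof.
have h2 a b c d a' b' c' d' : X a b * X c d - X a' b' * X c' d' \is 2.-homog.
  by apply: rpredB; apply: (@dhomogM _ _ _ 1 _ 1); exact: homog_var.
by apply: rpredD; [apply: rpredB|]; apply: (@dhomogM _ _ _ 1 _ 2);
   rewrite ?homog_var ?h2.
Qed.

(* [a = 0], [b = 1], [c = 2], [d = 3] and [w = 4]: the minors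
   [abc abd acd bcd abw acw]. *)
Definition six_minors (s : 'I_6) : S :=
  nth 0 [:: minor3 c0 c1 c2; minor3 c0 c1 c3; minor3 c0 c2 c3;
            minor3 c1 c2 c3; minor3 c0 c1 c4; minor3 c0 c2 c4] s.

Lemma six_minors_prime s : prime_elt (six_minors s).
Proof.
by case: s => [[|[|[|[|[|[|//]]]]]] ?]; apply: prime_minor3.
Qed.

Lemma six_minors_smooth s :
  exists c, ~ divides (six_minors s) (der c (six_minors s)).
Proof.
by case: s => [[|[|[|[|[|[|//]]]]]] ?]; apply: minor3_smooth.
Qed.

Lemma six_minors_homog s : six_minors s \is 3.-homog.
Proof.
by case: s => [[|[|[|[|[|[|//]]]]]] ?]; apply: homog_minor3.
Qed.

Definition six_pts (s : 'I_6) : 'I_3 -> 'I_5 -> K :=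
  nth (basis_pt c0 c1 c2)
    [:: basis_pt c0 c1 c2; basis_pt c0 c1 c3; basis_pt c0 c2 c3;
        basis_pt c1 c2 c3; basis_pt c0 c1 c4; basis_pt c0 c2 c4] s.

Lemma ev_six_minors s s' : ev (six_pts s) (six_minors s') = (s == s')%:R.
Proof.
case: s s' => [[|[|[|[|[|[|//]]]]]] ?] [[|[|[|[|[|[|//]]]]]] ?];
  by rewrite /six_minors /six_pts /minor3 /= !evE /basis_pt /=; ring.
Qed.

Lemma six_minors_ndvd s s' : s != s' -> ~ divides (six_minors s) (six_minors s').
Proof.
move=> ss'; apply: (@ev_ndvd (six_pts s')); rewrite ev_six_minors.
  by rewrite eq_sym (negbTE ss').
by rewrite eqxx oner_neq0.
Qed.

Lemma six_minors_prod_homog : \prod_s six_minors s \is 18.-homog.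
Proof.
have := dhomog_bigprod six_minors_homog.
by rewrite big_const_ord.
Qed.

(** * Logarithmic derivations of the six minors *)

Local Notation o k := (@Ordinal 15 k isT).

Implicit Type c : 'rV[S]_15.

(* The coordinates of [c] are the entries of the matrix acting on the rows
   [0-8], a parameter [9] for the weights of the columns [a] and [b], the weights
   of [c] and [w] [10-11], the coefficients of [w += a] [12] and of the derivation
   of degree 4 [13], and the eigenvalue on the product of the six minors [14].
   Scaling all the rows amounts to scaling all the columns, hence the weight 0
   given to [d]. The columns occur in [5, 4, 4, 3, 2] of the minors; as
   [5 - 4 = 1], the weights of [a] and [b] can be adjusted to get any eigenvalue. *)
Definition row_coef c (r p : nat) : S :=
  nth 0 [:: c 0 (o 0); c 0 (o 1); c 0 (o 2); c 0 (o 3); c 0 (o 4); c 0 (o 5);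
            c 0 (o 6); c 0 (o 7); c 0 (o 8)] (3 * r + p).

Definition row_trace c := row_coef c 0 0 + row_coef c 1 1 + row_coef c 2 2.

Definition col_shift c :=
  c 0 (o 14) - (row_trace c *+ 6 + c 0 (o 10) *+ 4 + c 0 (o 11) *+ 2).

(** The multiples 4 and -5 cancel on the product, where [a] and [b] occur 5 and 4 times. *)
Definition col_weight c (j : 'I_5) : S :=
  nth 0 [:: col_shift c + c 0 (o 9) *+ 4; - col_shift c - c 0 (o 9) *+ 5;
            c 0 (o 10); 0; c 0 (o 11)] j.

Definition linear_der c (r : 'I_3) (j : 'I_5) : S :=
  row_coef c r 0 * X r0 j + row_coef c r 1 * X r1 j + row_coef c r 2 * X r2 j
  + col_weight c j * X r j + (if j == c4 then c 0 (o 12) * X r c0 else 0).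

(* [abw * c] added to the column [w] multiplies [abw] by [abc] and kills [acw];
   the first term restores the eigenvalue 0 on the product. *)
Definition quartic_der (r : 'I_3) (j : 'I_5) : S :=
  nth 0 [:: - minor3 c0 c1 c2; minor3 c0 c1 c2; 0; 0; 0] j * X r j
  + (if j == c4 then minor3 c0 c1 c4 * X r c2 else 0).

Definition log_der c r j := linear_der c r j + c 0 (o 13) * quartic_der r j.

(** The operation [w += a] contributes nothing, as [a] is in both minors containing [w]. *)
Definition log_eigenvalue c (s : 'I_6) : S :=
  let w0 := col_weight c c0 - c 0 (o 13) * minor3 c0 c1 c2 in
  let w1 := col_weight c c1 + c 0 (o 13) * minor3 c0 c1 c2 in
  let w2 := c 0 (o 10) in let w4 := c 0 (o 11) in
  row_trace c +
  nth 0 [:: w0 + w1 + w2; w0 + w1; w0 + w2; w1 + w2;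
            w0 + w1 + w4 + c 0 (o 13) * minor3 c0 c1 c2; w0 + w2 + w4] s.

Definition log_row c := field_row (log_der c).

Lemma der_six_minors c s :
  der (log_row c) (six_minors s) = log_eigenvalue c s * six_minors s.
Proof.
rewrite /six_minors /log_eigenvalue.
by case: s => [[|[|[|[|[|[|//]]]]]] ?] /=; rewrite {1}/minor3;
  rewrite !(derD, derN, derM) !der_field_row /log_der /linear_der /quartic_der
    /row_trace /row_coef /col_weight /=; rewrite /minor3; ring.
Qed.

Lemma log_row_logarithmic c : logarithmic six_minors (log_row c).
Proof. by move=> s; exists (log_eigenvalue c s); rewrite der_six_minors. Qed.

Lemma sum_log_eigenvalue c : \sum_s log_eigenvalue c s = c 0 (o 14).
Proof.
rewrite !big_ord_recl big_ord0 /log_eigenvalue /= /col_weight /= /col_shift.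
by ring.
Qed.

Lemma der_six_minors_prod c :
  der (log_row c) (\prod_s six_minors s) = c 0 (o 14) * \prod_s six_minors s.
Proof.
rewrite -sum_log_eigenvalue.
elim: (index_enum _) => [|s l IHl].
  by rewrite !big_nil mul0r -[1](@mpolyC1 15 K) /der big1 // => v _;
     rewrite mderivC mulr0.
by rewrite !big_cons derM IHl der_six_minors; ring.
Qed.

Lemma log_row_is_linear : linear log_row.
Proof.
move=> a c d; apply/rowP => v; rewrite !mxE.
case: (e' v) => r j /=.
rewrite /log_der /linear_der /quartic_der /col_weight /col_shift /row_trace.
by case: j => [[|[|[|[|[|//]]]]] ?] /=; case: r => [[|[|[|//]]] ?];
  rewrite /row_coef /= !mxE; ring.
Qed.

HB.instance Definition _ :=
  GRing.isLinear.Build S 'rV[S]_15 'rV[S]_15 _ log_row log_row_is_linear.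

Definition log_mx : 'M[S]_15 := lin1_mx log_row.

Lemma row_log_mx k : row k log_mx = log_row (delta_mx 0 k).
Proof. by rewrite rowE mul_rV_lin1. Qed.

(** The default 1 is the degree of the last row, which has eigenvalue 1 and is left out of the
    basis. *)
Definition log_mx_degree (k : nat) := nth 1%N (nseq 13 1 ++ [:: 4])%N k.

Lemma linear_der_homog c r j :
  (forall k, c 0 k \is 0.-homog) -> linear_der c r j \is 1.-homog.
Proof.
move=> c_0.
have nth_0 (l : seq S) n :
    all (fun p : S => p \is 0.-homog) l -> nth 0 l n \is 0.-homog.
  by elim: l n => [|p l IHl] [|n] //=; rewrite ?rpred0 // => /andP[? /IHl].
have r_0 p p' : row_coef c p p' \is 0.-homog by apply: nth_0; rewrite /= !c_0.
have X_1 (p : S) r' j' : p \is 0.-homog -> p * X r' j' \is 1.-homog.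
  by move=> p_0; apply: (@dhomogM _ _ _ 0 _ 1) => //; apply: homog_var.
have sh_0 : col_shift c \is 0.-homog.
  by apply: rpredB => //; do ?[apply: rpredD | apply: rpredMn].
have w_0 : col_weight c j \is 0.-homog.
  apply: nth_0; rewrite /= !c_0 rpred0 !andbT.
  apply/andP; split; first by apply: rpredD => //; apply: rpredMn.
  by apply: rpredB; [rewrite rpredN | apply: rpredMn].
apply: rpredD; first by do ?apply: rpredD; apply: X_1.
by case: ifP => _; rewrite ?rpred0 ?X_1.
Qed.

Lemma quartic_der_homog r j : quartic_der r j \is 4.-homog.
Proof.
have X_4 (p : S) r' j' : p \is 3.-homog -> p * X r' j' \is 4.-homog.
  by move=> p_3; apply: (@dhomogM _ _ _ 3 _ 1) => //; apply: homog_var.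
apply: rpredD; last by case: ifP => _; rewrite ?rpred0 ?X_4 ?homog_minor3.
have ND_3 : - minor3 c0 c1 c2 \is 3.-homog.
  by rewrite rpredN; apply: homog_minor3.
by apply: X_4; case: j => [[|[|[|[|[|//]]]]] ?] /=;
   rewrite ?rpred0 ?ND_3 ?homog_minor3.
Qed.

Lemma log_mx_homog k v : log_mx k v \is (log_mx_degree k).-homog.
Proof.
have -> : log_mx k v = row k log_mx 0 v by rewrite [RHS]mxE.
rewrite row_log_mx mxE /log_der; case: (e' v) => r j /=.
have d_0 k' : (delta_mx 0 k : 'rV[S]_15) 0 k' \is 0.-homog.
  by rewrite mxE; case: (_ && _); rewrite ?rpred0 ?dhomog1.
(* Only row 13 has a quartic part, and its linear part is 0. *)
have [k13|k13] := eqVneq (k : nat) 13; last first.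
  have -> : (delta_mx 0 k : 'rV[S]_15) 0 (o 13) = 0.
    by rewrite mxE (_ : (_ == k) = false) //; apply/negbTE; rewrite eq_sym.
  rewrite mul0r addr0 (_ : log_mx_degree k = 1%N) ?linear_der_homog //.
  rewrite /log_mx_degree; case: k k13 {d_0} => k /= klt; move: klt.
  by do 15!case: k => [|k] //.
have -> : log_mx_degree k = 4 by rewrite k13.
have kE : k = o 13 by apply: val_inj.
have -> : linear_der (delta_mx 0 k) r j = 0.
  rewrite kE /linear_der /col_weight /col_shift /row_trace.
  by case: j => [[|[|[|[|[|//]]]]] ?] /=; case: r => [[|[|[|//]]] ?];
    rewrite /row_coef /= !mxE /=; ring.
rewrite add0r kE mxE /= mul1r; exact: quartic_der_homog.
Qed.

(** * Nonvanishing of the determinant *)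

Definition generic_pt (r : 'I_3) (j : 'I_5) : K :=
  nth 0 [:: (r == r0)%:R; (r == r1)%:R; (r == r2)%:R; 1; (r != r0)%:R] j.

Local Ltac ev_log_der evc :=
  rewrite /log_der /linear_der /quartic_der /col_weight /col_shift /row_trace
    /row_coef /minor3 /= !(evE, evc) /generic_pt /=.

(** None of the six minors vanishes at [generic_pt]. If [x] is in the left kernel of the matrix
    evaluated there, the entries of [x *m _], read in a suitable order, make the coordinates of [x]
    vanish one by one. *)
Lemma det_log_mx_neq0 : \det log_mx != 0.
Proof.
apply/eqP => det0.
have : \det (map_mx (ev generic_pt) log_mx) == 0.
  by rewrite det_map_mx det0 rmorph0.
case/det0P => x x0; pose c : 'rV[S]_15 := map_mx (@mpolyC 15 K) x.
have -> : x = map_mx (ev generic_pt) c.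
  by apply/rowP => k; rewrite !mxE /ev mevalC.
rewrite -map_mxM mul_rV_lin1 => /rowP E.
have {}E r j : ev generic_pt (log_der c r j) = 0.
  by have := E (e r j); rewrite !mxE eK.
have evc k : ev generic_pt (c 0 k) = x 0 k by rewrite mxE /ev mevalC.
(* The zeros in columns [a], [b], [c] isolate the off-diagonal row operations; column [d], of weight
   0, then gives the diagonal ones. *)
have a3 : x 0 (o 3) = 0.
  by rewrite -[RHS](E r1 c0); ev_log_der evc; ring.
have a6 : x 0 (o 6) = 0.
  by rewrite -[RHS](E r2 c0); ev_log_der evc; ring.
have a1 : x 0 (o 1) = 0.
  by rewrite -[RHS](E r0 c1); ev_log_der evc; ring.
have a7 : x 0 (o 7) = 0.
  by rewrite -[RHS](E r2 c1); ev_log_der evc; ring.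
have a2 : x 0 (o 2) = 0.
  by rewrite -[RHS](E r0 c2); ev_log_der evc; ring.
have a5 : x 0 (o 5) = 0.
  by rewrite -[RHS](E r1 c2); ev_log_der evc; ring.
have a0 : x 0 (o 0) = 0.
  by rewrite -[RHS](E r0 c3); ev_log_der evc; rewrite !(a1, a2); ring.
have a4 : x 0 (o 4) = 0.
  by rewrite -[RHS](E r1 c3); ev_log_der evc; rewrite !(a3, a5); ring.
have a8 : x 0 (o 8) = 0.
  by rewrite -[RHS](E r2 c3); ev_log_der evc; rewrite !(a6, a7); ring.
have a10 : x 0 (o 10) = 0.
  by rewrite -[RHS](E r2 c2); ev_log_der evc; rewrite !(a8, a6, a7); ring.
(* In column [w] at this point, [w += a] affects only the first entry, the scaling only the other
   two, and the quartic term only the third. *)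
have a12 : x 0 (o 12) = 0.
  by rewrite -[RHS](E r0 c4); ev_log_der evc; rewrite !(a0, a1, a2); ring.
have a11 : x 0 (o 11) = 0.
  by rewrite -[RHS](E r1 c4); ev_log_der evc; rewrite !(a3, a4, a5); ring.
have a13 : x 0 (o 13) = 0.
  by rewrite -[RHS](E r2 c4); ev_log_der evc; rewrite !(a6, a7, a8, a11); ring.
have a9 : x 0 (o 9) = 0.
  (* In the sum of the weights of [a] and [b], [col_shift] cancels and 4 - 5 = -1 remains. *)
  rewrite (_ : x 0 (o 9) = - (ev generic_pt (log_der c r0 c0)
                              + ev generic_pt (log_der c r1 c1))).
    by rewrite !E addr0 oppr0.
  by ev_log_der evc;
     rewrite !(a0, a1, a2, a3, a4, a5, a6, a7, a8, a10, a11, a13); ring.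
have a14 : x 0 (o 14) = 0.
  by rewrite -[RHS](E r0 c0); ev_log_der evc;
     rewrite !(a0, a1, a2, a3, a4, a5, a6, a7, a8, a9, a10, a11, a13); ring.
move/eqP: x0; apply; apply/rowP => -[k klt]; rewrite mxE.
have xk (m : 'I_15) : x 0 m = 0 -> m = k :> nat -> x 0 (Ordinal klt) = 0.
  by move=> <- mk; congr (x 0 _); apply: val_inj.
do 15![case: k klt xk => [|k] klt xk; first by [apply: xk a0 _ | apply: xk a1 _
  | apply: xk a2 _ | apply: xk a3 _ | apply: xk a4 _ | apply: xk a5 _
  | apply: xk a6 _ | apply: xk a7 _ | apply: xk a8 _ | apply: xk a9 _
  | apply: xk a10 _ | apply: xk a11 _ | apply: xk a12 _ | apply: xk a13 _
  | apply: xk a14 _]].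
by [].
Qed.

(** * Freeness and exponents for the six minors *)

Lemma log_mx_AR_basis :
  AR_basis (\prod_s six_minors s)
    (fun j : 'I_14 => row (widen_ord (leqnSn 14) j) log_mx).
Proof.
apply: (@saito_AR_basis _ _ _ _ six_minors_prime six_minors_ndvd six_minors_smooth
  log_mx log_mx_degree) => [k|||||].
- by rewrite row_log_mx; apply: log_row_logarithmic.
- exact: log_mx_homog.
- rewrite (_ : (\sum_(i < 15) log_mx_degree i)%N = 18) ?six_minors_prod_homog //.
  by rewrite !big_ord_recr big_ord0.
- exact: det_log_mx_neq0.
- move=> j; apply/eqP; rewrite -/(der _ _) row_log_mx der_six_minors_prod mxE.
  have -> : (o 14 == widen_ord (leqnSn 14) j) = false.
    by rewrite -val_eqE /= gtn_eqF.
  by rewrite andbF mul0r.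
- by rewrite row_log_mx der_six_minors_prod mxE mul1r.
Qed.

Lemma six_minors_free : free_hypersurface (\prod_s six_minors s).
Proof.
split.
- exact: homogE six_minors_prod_homog.
- exact: (prod_primes_reduced six_minors_prime six_minors_ndvd).
- by eexists; eexists; apply: log_mx_AR_basis.
Qed.

Lemma six_minors_exponents :
  has_exponents (\prod_s six_minors s) (nseq 13 1 ++ [:: 4])%N.
Proof.
exists (fun j : 'I_14 => row (widen_ord (leqnSn 14) j) log_mx).
  exact: log_mx_AR_basis.
move=> i v; rewrite mxE; have := log_mx_homog (widen_ord (leqnSn 14) i) v.
(* The two defaults of [nth] differ only beyond the 14 exponents. *)
by rewrite /log_mx_degree (set_nth_default 0%N) ?(ltn_ord i).
Qed.

End SixMinors.

(** * Invariance under a change of sign *)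

Section Opposite.
Variables (K : fieldType) (n : nat).
Implicit Type F : {mpoly K[n]}.

Lemma mem_AR_opp F : AR (- F) =i AR F.
Proof.
move=> a; rewrite /AR /= !unfold_in /=.
by under eq_bigr do rewrite mderivN mulrN; rewrite sumrN oppr_eq0.
Qed.

Lemma AR_basis_opp F r (b : 'I_r -> 'rV_n) : AR_basis F b -> AR_basis (- F) b.
Proof.
by case=> bF bP; split=> [i|a]; rewrite mem_AR_opp //; apply: bP.
Qed.

Lemma free_hypersurface_opp F : free_hypersurface F -> free_hypersurface (- F).
Proof.
move=> [/homogP[d Fd] redF [r [b bP]]]; split.
- by apply: (@homogE _ _ _ d); rewrite rpredN; apply: Fd.
- by move=> p q E; apply: (redF p (- q)); rewrite mulrN -E opprK.
by exists r, b; apply: AR_basis_opp.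
Qed.

Lemma has_exponents_opp F ds : has_exponents F ds -> has_exponents (- F) ds.
Proof. by case=> b bP b_ds; exists b => //; apply: AR_basis_opp. Qed.

End Opposite.

(** * Reduction to the six minors by permuting columns *)

Section PermutedColumns.
Variable K : fieldType.

(** [sg] lists the 0-based columns playing the roles [a], [b], [c], [d], [w]. *)
Definition var_index (sg : seq nat) (i : 'I_3) (j : 'I_5) : 'I_15 :=
  inord (5 * i + nth 0 sg j)%N.

Definition var_coord (sg : seq nat) (v : 'I_15) : 'I_3 * 'I_5 :=
  (inord (v %/ 5)%N, inord (index (v %% 5)%N sg)).

Lemma nth_perm_iota sg (j : 'I_5) : perm_eq sg (iota 0 5) -> (nth 0%N sg j < 5)%N.
Proof.
move=> sg5; have : nth 0%N sg j \in iota 0 5.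
  by rewrite -(perm_mem sg5) mem_nth // (perm_size sg5).
by rewrite mem_iota.
Qed.

Lemma var_indexK sg i j : perm_eq sg (iota 0 5) ->
  var_coord sg (var_index sg i j) = (i, j).
Proof.
move=> sg5; have sz : size sg = 5 by rewrite (perm_size sg5).
have lt5 := nth_perm_iota j sg5.
have lt15 : (5 * i + nth 0 sg j < 15)%N.
  rewrite (@leq_trans (5 * i + 5)) ?ltn_add2l // -mulnSr (leq_mul2l 5 _ 3).
  exact: ltn_ord.
rewrite /var_coord /var_index inordK // mulnC divnMDl // divn_small // addn0.
rewrite modnMDl modn_small // index_uniq ?sz ?(perm_uniq sg5) //.
by rewrite !inord_val.
Qed.

Lemma det3E (R : comNzRingType) (g : nat -> nat -> R) :
  \det (\matrix_(i < 3, j < 3) g i j) =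
      g 0 0 * (g 1 1 * g 2 2 - g 2 1 * g 1 2)
    - g 1 0 * (g 0 1 * g 2 2 - g 2 1 * g 0 2)
    + g 2 0 * (g 0 1 * g 1 2 - g 1 1 * g 0 2).
Proof.
rewrite (expand_det_col _ ord0) !big_ord_recl big_ord0 /cofactor.
rewrite !(expand_det_row _ ord0) !big_ord_recl !big_ord0 /cofactor !det_mx11.
by rewrite !mxE /= /bump /= !addn0 !add0n ?addn1 !expr0 !expr1; ring.
Qed.

Lemma DeltaE a b c : (0 < a <= 5)%N -> (0 < b <= 5)%N -> (0 < c <= 5)%N ->
  let Z i j : {mpoly K[15]} := 'X_(inord (5 * i + j.-1)) in
  Delta K a b c =
      Z 0 a * (Z 1 b * Z 2 c - Z 2 b * Z 1 c)
    - Z 1 a * (Z 0 b * Z 2 c - Z 2 b * Z 0 c)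
    + Z 2 a * (Z 0 b * Z 1 c - Z 1 b * Z 0 c).
Proof.
move=> a5 b5 c5 Z; rewrite /Delta.
pose g i j := Z i (nth 0 [:: a; b; c] j).
rewrite (_ : colsub _ _ = \matrix_(i < 3, j < 3) g i j) ?det3E //.
apply/matrixP => i j; rewrite !mxE; congr 'X_(inord (_ + _)).
by rewrite inordK //; case: j => [[|[|[|//]]] ?] /=; lia.
Qed.

Lemma Delta_swap12 a b c : (0 < a <= 5)%N -> (0 < b <= 5)%N -> (0 < c <= 5)%N ->
  Delta K b a c = - Delta K a b c.
Proof. by move=> a5 b5 c5; rewrite !DeltaE //=; ring. Qed.

Lemma Delta_swap23 a b c : (0 < a <= 5)%N -> (0 < b <= 5)%N -> (0 < c <= 5)%N ->
  Delta K a c b = - Delta K a b c.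
Proof. by move=> a5 b5 c5; rewrite !DeltaE //=; ring. Qed.

Lemma minor3_Delta sg (i j k : 'I_5) : perm_eq sg (iota 0 5) ->
  minor3 K (var_index sg) i j k =
  Delta K (nth 0%N sg i).+1 (nth 0%N sg j).+1 (nth 0%N sg k).+1.
Proof. by move=> sg5; rewrite DeltaE //= ?nth_perm_iota. Qed.

(** Besides column 5, [f 5] and [f k] share one column, taken as [a]; the remaining columns of [f 5]
    and [f k] are [b] and [c]. Sorting the columns of the minors gives the sign, negative for [k]
    equal to 7 or 9. *)
Lemma six_minors_Q (k : nat) : k \in [:: 6; 7; 8; 9]%N ->
  exists2 sg, perm_eq sg (iota 0 5) &
    Q K k = \prod_s six_minors K (var_index sg) s \/
    Q K k = - \prod_s six_minors K (var_index sg) s.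
Proof.
(* [Delta] is abstracted lest conversion unfold the determinants. *)
have s12 := Delta_swap12; have s23 := Delta_swap23; have mE := minor3_Delta.
rewrite /Q /f; move: (Delta K) s12 s23 mE => d s12 s23 mE.
rewrite !inE => /or4P[] /eqP ->;
  [exists [:: 0; 1; 2; 3; 4]%N => //; left
  |exists [:: 1; 0; 2; 3; 4]%N => //; right
  |exists [:: 0; 1; 3; 2; 4]%N => //; left
  |exists [:: 1; 0; 3; 2; 4]%N => //; right];
rewrite !big_ord_recl big_ord0 mulr1 /six_minors /= !mE //=;
rewrite ?(s12 1 2 3) ?(s12 1 2 4) ?(s12 1 2 5) //;
rewrite ?(s23 1 3 4) ?(s23 2 3 4) //; ring.
Qed.

End PermutedColumns.

Local Close Scope ring_scope.

Theorem theorem1p8 (R : realType) (k : nat) (hk : k \in [:: 6; 7; 8; 9]) :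
  free_hypersurface (Q R[i]%C k) /\
  has_exponents (Q R[i]%C k) (nseq 13 1 ++ [:: 4]).
Proof.
have [sg sg5 QE] := six_minors_Q R[i]%C hk.
have eK i j := var_indexK i j sg5.
have free := six_minors_free R[i]%C eK.
have expo := six_minors_exponents R[i]%C eK.
case: QE => ->; first by split.
by split; [apply: free_hypersurface_opp | apply: has_exponents_opp].
Qed.
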